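(* Let $\Sigma\subseteq\mathbb{C}$ be a nonempty compact set, let $L$ be a bounded band operator on $\ell^2(\mathbb{Z})$ with $LS=SL$, let $\gamma\in\mathbb{Z}$, and for $u\in\Sigma^{\mathbb{Z}}$ put $H(u):=L+S^\gamma M_u$. If $b,c\in\Sigma^{\mathbb{Z}}$ satisfy $\mathcal{W}(b)\subseteq\mathcal{W}(c)$, then $\nu(H(b))\ge\nu(H(c))$ and \[ \|(H(b)-\lambda)^{-1}\|\le\|(H(c)-\lambda)^{-1}\|\quad\text{for all }\lambda\in\mathbb{C}, \] so that $\sigma(H(b))\subseteq\sigma(H(c))$ and $\sigma_\varepsilon(H(b))\subseteq\sigma_\varepsilon(H(c))$ for all $\varepsilon>0$.
   Context: $(Sx)_n=x_{n-1}$ on $\ell^2(\mathbb{Z})$; $(M_ux)_n=u_nx_n$. A band operator is a finite sum $\sum_{k=-w}^{w}M_{a^{(k)}}S^k$ with $a^{(k)}\in\ell^\infty(\mathbb{Z})$. $\mathcal{W}(u)$ is the set of all finite subwords of $u$, i.e. all words $(u(k),\dots,u(k+n-1))$ with $k\in\mathbb{Z}$, $n\ge 0$. The lower norm of a bounded operator $T$ is $\nu(T):=\inf\{\|Tx\|:\|x\|=1\}$. $\sigma_\varepsilon(T):=\{\lambda:\|(T-\lambda)^{-1}\|>1/\varepsilon\}$, with the convention $\|B^{-1}\|:=\infty$ if $B$ is not invertible. *)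

(* Defs.v *)
From HB Require Import structures.
From mathcomp Require Import all_boot all_order all_algebra.
From mathcomp Require Import all_classical all_reals all_analysis.
From mathcomp Require Import complex.
Set Implicit Arguments. Unset Strict Implicit. Unset Printing Implicit Defensive.
Import Order.TTheory GRing.Theory Num.Theory.
Local Open Scope classical_set_scope.
Local Open Scope ring_scope.

Section L2Z.
Variable R : realType.
Local Notation C := (R[i]).

Definition cmod2 (z : C) : R := (complex.Re z) ^+ 2 + (complex.Im z) ^+ 2.

Definition seqZ := int -> C.
Definition op := seqZ -> seqZ.

Definition sqnorm (x : seqZ) : \bar R := \esum_(n in [set: int]) (cmod2 (x n))%:E.

Definition l2 (x : seqZ) : Prop := (sqnorm x < +oo)%E.

Definition enorm (x : seqZ) : \bar R :=
  match sqnorm x with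
  | r%:E => (Num.sqrt r)%:E
  | _ => +oo%E
  end.

Definition shiftS : op := fun x n => x (n - 1).
Definition shiftk (k : int) : op := fun x n => x (n - k).

Definition mulop (u : seqZ) : op := fun x n => u n * x n.

Definition band_op (w : nat) (a : int -> seqZ) : op :=
  fun x n => \sum_(j < (2 * w).+1) a (j%:Z - w%:Z) n * x (n - (j%:Z - w%:Z)).

Definition bounded_coeffs (w : nat) (a : int -> seqZ) : Prop :=
  exists B : R, forall k n, (- w%:Z <= k <= w%:Z)%R -> cmod2 (a k n) <= B.

Definition sub_scal (T : op) (lam : C) : op := fun x n => T x n - lam * x n.

Definition is_inverse (T Binv : op) : Prop :=
  [/\ forall x, l2 x -> l2 (T x),
      forall y, l2 y -> l2 (Binv y),
      forall x, l2 x -> Binv (T x) = x,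
      forall y, l2 y -> T (Binv y) = y
    & exists M : R, forall y, l2 y -> (enorm (Binv y) <= M%:E * enorm y)%E].

Definition invertible (T : op) : Prop := exists Binv, is_inverse T Binv.

Definition unit_l2 : set seqZ := [set x | l2 x /\ enorm x = 1%E].

Definition lower_norm (T : op) : \bar R :=
  ereal_inf [set enorm (T x) | x in unit_l2].

Definition inv_norm (B : op) : \bar R :=
  if pselect (invertible B) is left _ then
    ereal_sup [set r | exists Binv y, [/\ is_inverse B Binv, unit_l2 y & r = enorm (Binv y)]]
  else +oo%E.

Definition resolvent_norm (T : op) (lam : C) : \bar R := inv_norm (sub_scal T lam).

Definition spectrum (T : op) : set C := [set lam | ~ invertible (sub_scal T lam)].
Definition pseudospectrum (eps : R) (T : op) : set C :=
  [set lam | ((eps^-1)%:E < resolvent_norm T lam)%E].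

(* compactness of a subset of C, with C carrying its usual topology
   (identified with R x R via z |-> (Re z, Im z)) *)
Definition ccompact (K : set C) : Prop :=
  compact ([set (complex.Re z, complex.Im z) | z in K] : set (R^o * R^o)%type).

Definition subwords (u : seqZ) : set (seq C) :=
  [set s | exists k : int, s = mkseq (fun i => u (k + i%:Z)) (size s)].

Definition Hop (L : op) (gamma : int) (u : seqZ) : op :=
  fun x n => L x n + shiftk gamma (mulop u x) n.

End L2Z.

(* Main.v *)
Require Import Defs.
From HB Require Import structures.
From mathcomp Require Import all_boot all_order all_algebra finmap.
From mathcomp Require Import all_classical all_reals all_analysis.
From mathcomp Require Import complex ring lra zify.
Import Order.TTheory GRing.Theory Num.Theory.
Import numFieldNormedType.Exports.
Local Open Scope classical_set_scope.
Local Open Scope ring_scope.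

(** Since [L] commutes with the shift, its coefficients are constant, so a
    translate of [H(u)] is [H] of a translate of [u], and every finite window
    of [b] occurs in some translate of [c].

    Lower bounds [m |x|^2 <= |H(c)x|^2] pass to [H(b)]: translate a finitely
    supported [x] to where [c] looks like [b], then approximate in [l2].

    For surjectivity no adjoint is needed. If [c_N] is a translate of [c]
    agreeing with [b] on [[-N, N]], then the solutions of [H(c_N) x_N = y] have
    norms bounded by that of the inverse of [H(c)], and any coordinatewise
    limit [x] along an ultrafilter satisfies [H(b) x = y] with the same bound. *)

Set Implicit Arguments.
Unset Strict Implicit.
Unset Printing Implicit Defensive.

(** * The squared modulus on the complex numbers *)

Section Modulus.
Variable R : realType.
Implicit Types z t : R[i].

Lemma cmod2_ge0 z : 0 <= cmod2 z.
Proof. by rewrite /cmod2 addr_ge0 ?sqr_ge0. Qed.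

Lemma cmod2_eq0 z : cmod2 z = 0 -> z = 0.
Proof.
case: z => x y /eqP; rewrite /cmod2 /= paddr_eq0 ?sqr_ge0// !sqrf_eq0.
by move=> /andP[/eqP -> /eqP ->].
Qed.

Lemma cmod20 : cmod2 (0 : R[i]) = 0.
Proof. by rewrite /cmod2 /=; ring. Qed.

Lemma cmod21 : cmod2 (1 : R[i]) = 1.
Proof. by rewrite /cmod2 /=; ring. Qed.

Lemma cmod2N z : cmod2 (- z) = cmod2 z.
Proof. by case: z => x y; rewrite /cmod2 /=; ring. Qed.

Lemma cmod2M z t : cmod2 (z * t) = cmod2 z * cmod2 t.
Proof. by case: z t => x y [u v]; rewrite /cmod2 /=; ring. Qed.

Lemma cmod2_real (r : R) : cmod2 (r%:C)%C = r ^+ 2.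
Proof. by rewrite /cmod2 /=; ring. Qed.

(* Young's inequality [2 x u <= d x^2 + u^2 / d] on each component. *)
Lemma cmod2D_le (d : R) z t : 0 < d ->
  cmod2 (z + t) <= (1 + d) * cmod2 z + (1 + d^-1) * cmod2 t.
Proof.
move=> d0; case: z t => x y [u v]; rewrite /cmod2 /= -subr_ge0.
have -> : (1 + d) * (x ^+ 2 + y ^+ 2) + (1 + d^-1) * (u ^+ 2 + v ^+ 2)
    - ((x + u) ^+ 2 + (y + v) ^+ 2)
    = d^-1 * ((d * x - u) ^+ 2 + (d * y - v) ^+ 2).
  by field; rewrite gt_eqF.
by rewrite mulr_ge0 ?invr_ge0 ?(ltW d0)// addr_ge0 ?sqr_ge0.
Qed.

Lemma ccompact_bounded (K : set R[i]) : ccompact K ->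
  exists B : R, forall z, K z -> cmod2 z <= B.
Proof.
move=> /compact_bounded[M [_ /(_ (`|M| + 1))]].
(* Any number above [M] bounds the max norm on the image of [K]. The choice [|M| + 1] is also
   nonnegative, so it can be squared in both components. *)
have -> : M < `|M| + 1 by rewrite (le_lt_trans (ler_norm _))// ltrDl.
move=> /(_ isT) H; exists ((`|M| + 1) ^+ 2 + (`|M| + 1) ^+ 2) => z Kz.
have /H : ([set (complex.Re z, complex.Im z) | z in K] : set (R^o * R^o)%type)
  (complex.Re z, complex.Im z) by exists z.
rewrite /= prod_normE /= ge_max => /andP[h1 h2].
by rewrite /cmod2 lerD// -[X in X <= _]real_normK ?num_real// lerXn2r ?nnegrE.
Qed.

End Modulus.

(** * Square sums over the integers, and their relation to [enorm] *)

Section SquareNorm.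
Variable R : realType.
Implicit Types x y : seqZ R.

Lemma sqnorm_ge0 x : (0 <= sqnorm x)%E.
Proof. by apply: esum_ge0 => n _; rewrite lee_fin cmod2_ge0. Qed.

Lemma fineK_l2 x : l2 x -> ((fine (sqnorm x))%:E = sqnorm x)%E.
Proof. by move=> xl2; rewrite fineK// ge0_fin_numE ?sqnorm_ge0. Qed.

Lemma sum_le_sqnorm x (F : {fset int}) :
  ((\sum_(n <- F) cmod2 (x n))%:E <= sqnorm x)%E.
Proof.
apply: esum_ge; exists [set` F]; first by split => //; exact: finite_fset.
by rewrite fsbig_finite//= set_fsetK sumEFin.
Qed.

(** The sum is a supremum over finite sets, so every norm estimate below reduces to one on finite
    sums. *)
Lemma sqnorm_le x (M : R) :
  (forall F : {fset int}, \sum_(n <- F) cmod2 (x n) <= M) ->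
  (sqnorm x <= M%:E)%E.
Proof.
move=> H; apply: ge_ereal_sup => _ [X [finX _] <-].
by rewrite fsbig_finite//= sumEFin lee_fin.
Qed.

Lemma sqnorm_gtP x (t : R) : (t%:E < sqnorm x)%E ->
  exists F : {fset int}, t < \sum_(n <- F) cmod2 (x n).
Proof.
move=> /ereal_sup_gt[_ [X [finX _] <-]].
by rewrite fsbig_finite//= sumEFin lte_fin; exists (fset_set X).
Qed.

Lemma cmod2_le_sqnorm x (M : R) n : (sqnorm x <= M%:E)%E -> cmod2 (x n) <= M.
Proof.
move=> xM; have := le_trans (sum_le_sqnorm x [fset n]%fset) xM.
by rewrite lee_fin big_seq_fset1.
Qed.

Lemma sum_le x (M : R) (F : {fset int}) : (sqnorm x <= M%:E)%E ->
  \sum_(n <- F) cmod2 (x n) <= M.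
Proof. by move=> xM; rewrite -lee_fin (le_trans (sum_le_sqnorm x F)). Qed.

Lemma sqnorm_mul_le (B M : R) (u : seqZ R) x : (forall n, cmod2 (u n) <= B) ->
  (sqnorm x <= M%:E)%E -> (sqnorm (fun n => (u n * x n)%R) <= (B * M)%:E)%E.
Proof.
move=> uB xM; apply: sqnorm_le => F.
have B0 : 0 <= B by rewrite (le_trans _ (uB 0))// cmod2_ge0.
rewrite (le_trans _ (ler_wpM2l B0 (sum_le F xM)))// mulr_sumr ler_sum// => n _.
by rewrite cmod2M ler_wpM2r ?cmod2_ge0.
Qed.

(** Young's inequality summed over coordinates. The free weight [d] lets the factor of the main term
    come arbitrarily close to 1 when the other term is small. *)
Lemma sqnormD_le (d M N : R) x y : 0 < d ->
  (sqnorm x <= M%:E)%E -> (sqnorm y <= N%:E)%E ->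
  (sqnorm (fun n => (x n + y n)%R) <= ((1 + d) * M + (1 + d^-1) * N)%:E)%E.
Proof.
move=> d0 xM yN; apply: sqnorm_le => F.
apply: (@le_trans _ _ ((1 + d) * \sum_(n <- F) cmod2 (x n)
                       + (1 + d^-1) * \sum_(n <- F) cmod2 (y n))).
  by rewrite !mulr_sumr -big_split/= ler_sum// => n _; exact: cmod2D_le.
by rewrite lerD// ler_wpM2l ?(sum_le F)// addr_ge0// ?invr_ge0 ltW.
Qed.

Lemma sqnorm_shiftk (k : int) x : sqnorm (shiftk k x) = sqnorm x.
Proof.
rewrite /sqnorm [RHS](@reindex_esum R int int setT setT (fun n => n - k))//.
split => // [n m _ _ /addIr //|n _].
by exists (n + k) => //; rewrite addrK.
Qed.

Lemma sqnorm0 : sqnorm (fun=> 0 : R[i]) = 0%E.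
Proof. by apply: esum1 => n _; rewrite cmod20. Qed.

Lemma sqnorm_eq0 x : sqnorm x = 0%E -> x = fun=> 0.
Proof.
move=> x0; apply/funext => n; apply/cmod2_eq0/eqP.
by rewrite eq_le cmod2_ge0 andbT; apply: cmod2_le_sqnorm; rewrite x0.
Qed.

(** The two pieces have disjoint supports. The minus sign makes the truncation of [x] to [F] equal
    to [x] plus the second piece. *)
Lemma sqnorm_split (F : {fset int}) x :
  (sqnorm x = sqnorm (fun n => if n \in F then x n else 0%R)
            + sqnorm (fun n => if n \in F then 0%R else - x n)%R)%E.
Proof.
rewrite /sqnorm -esumD => [|n _|n _]; rewrite ?lee_fin ?cmod2_ge0//.
by apply: eq_esum => n _; case: ifP; rewrite cmod20 ?cmod2N ?adde0 ?add0e.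
Qed.

Definition deltaZ (m : int) : seqZ R := fun n => if n == m then 1 else 0.

Lemma sqnorm_deltaZ m : sqnorm (deltaZ m) = 1%E.
Proof.
rewrite /sqnorm (esumID [set m]); last by move=> n _; rewrite lee_fin cmod2_ge0.
rewrite !setTI esum_set1 ?lee_fin ?cmod2_ge0// {1}/deltaZ eqxx cmod21 esum1 ?adde0//.
by move=> n /= /eqP/negbTE nm; rewrite /deltaZ nm cmod20.
Qed.

Lemma l2_le x (M : R) : (sqnorm x <= M%:E)%E -> l2 x.
Proof. by move=> h; exact: le_lt_trans h (ltry _). Qed.

Lemma l2_deltaZ m : l2 (deltaZ m).
Proof. by apply: (@l2_le _ 1); rewrite sqnorm_deltaZ. Qed.

Lemma l2_shiftk k x : l2 x -> l2 (shiftk k x).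
Proof. by rewrite /l2 sqnorm_shiftk. Qed.

Lemma sqnormZ_inv_sqrt x : l2 x -> (0 < sqnorm x)%E ->
  sqnorm (fun n => ((Num.sqrt (fine (sqnorm x)))^-1)%:C%C * x n) = 1%E.
Proof.
move=> /fineK_l2; set X := fine _ => Xx; rewrite -Xx lte_fin => X0.
set r := Num.sqrt X; have r0 : 0 < r by rewrite sqrtr_gt0.
have r2 : r ^+ 2 = X by rewrite sqr_sqrtr// ltW.
apply/eqP; rewrite eq_le; apply/andP; split.
  rewrite (le_trans (@sqnorm_mul_le (r^-1 ^+ 2) X _ _ _ _)) ?Xx//.
    by move=> n; rewrite cmod2_real.
  by rewrite -r2 -exprMn mulVf ?expr1n ?gt_eqF.
(* For the converse inequality, scale back by [r]: a norm below 1 would give [x] a square norm below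
   [r ^+ 2 = X]. *)
rewrite leNgt; apply/negP => lt1.
set y := (fun n => _) in lt1 *.
have yl2 : l2 y by apply: lt_trans lt1 (ltry _).
have /fineK_l2 Yy := yl2.
have : (sqnorm (fun n => (r%:C%C * y n)%R) <= (r ^+ 2 * fine (sqnorm y))%:E)%E.
  by apply: sqnorm_mul_le; rewrite ?Yy// => n; rewrite cmod2_real.
have -> : (fun n => r%:C%C * y n) = x.
  apply/funext => n; rewrite /y mulrA -rmorphM/= mulfV ?gt_eqF//.
  by rewrite mul1r.
move: lt1; rewrite -Xx -Yy lte_fin lee_fin r2 => lt1; apply/negP; rewrite -ltNge.
by rewrite -[ltRHS]mulr1 ltr_pM2l.
Qed.

Lemma enormE x : l2 x -> (enorm x = (Num.sqrt (fine (sqnorm x)))%:E)%E.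
Proof. by move=> /fineK_l2; rewrite /enorm; case: (sqnorm x). Qed.

Lemma enorm_ge0 x : (0 <= enorm x)%E.
Proof. by rewrite /enorm; case: sqnorm => [r||]//; rewrite lee_fin sqrtr_ge0. Qed.

Lemma enorm_leE x (r : R) : 0 <= r ->
  (enorm x <= r%:E)%E = (sqnorm x <= (r ^+ 2)%:E)%E.
Proof.
move=> r0; have := sqnorm_ge0 x; rewrite /enorm; case: sqnorm => [s||]//.
by rewrite !lee_fin => s0; rewrite -[RHS]ler_sqrt ?exprn_ge0// sqrtr_sqr ger0_norm.
Qed.

Lemma enorm_geE x (r : R) : 0 <= r ->
  (r%:E <= enorm x)%E = ((r ^+ 2)%:E <= sqnorm x)%E.
Proof.
move=> r0; have := sqnorm_ge0 x; rewrite /enorm; case: sqnorm => [s||]//.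
  by rewrite !lee_fin => s0; rewrite -[RHS]ler_sqrt// sqrtr_sqr ger0_norm.
by rewrite !leey.
Qed.

Lemma unit_l2E x : unit_l2 x <-> sqnorm x = 1%E.
Proof.
split => [[_ x1]|x1]; last first.
  by split; rewrite ?/l2 ?/enorm x1 ?ltry// sqrtr1.
apply/eqP; rewrite eq_le -(expr1n R 2) -enorm_leE ?ler01//.
by rewrite -enorm_geE ?ler01// x1 lexx.
Qed.

Lemma unit_l2_shiftk k x : unit_l2 x -> unit_l2 (shiftk k x).
Proof. by rewrite !unit_l2E sqnorm_shiftk. Qed.

End SquareNorm.

(** * Finite windows of [b] found in [c] *)

Section Window.
Variable R : realType.

Lemma subwords_window (b c : seqZ R) (N : nat) : subwords b `<=` subwords c ->
  exists k : int, forall m : int, (`|m| <= N)%N -> c (m + k) = b m.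
Proof.
pose s := mkseq (fun i => b (- N%:Z + i%:Z)) (2 * N).+1.
have bs : subwords b s by exists (- N%:Z); rewrite size_mkseq.
(* The word starts at [- N] in [b] and at [k] in [c], so the two occurrences differ by the
   translation [k + N]. *)
move=> /(_ _ bs)[k]; rewrite size_mkseq => sE; exists (k + N%:Z) => m mN.
have im : (`|(m + N%:Z)%R| < (2 * N).+1)%N by lia.
have := congr1 (fun t => nth 0 t `|(m + N%:Z)%R|%N) sE.
rewrite /= !nth_mkseq// gez0_abs; last by lia.
move=> h; have -> : m + (k + N%:Z) = k + (m + N%:Z) by lia.
by rewrite -h; congr (b _); lia.
Qed.

Lemma subwords_fset (b c : seqZ R) (F : {fset int}) :
  subwords b `<=` subwords c ->
  exists k : int, forall m : int, m \in F -> c (m + k) = b m.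
Proof.
move=> /(subwords_window (\max_(m <- F) `|m|%N))[k H]; exists k => m mF.
by apply: H; apply: (@leq_bigmax_seq _ (enum_fset F) xpredT (fun m : int => `|m|%N)).
Qed.

End Window.

(** * Constant-coefficient operators plus a shifted potential: algebraic rules *)

Section Toeplitz.
Variables (R : realType) (ps : seq (R[i] * int)) (g : int).
Implicit Types (u x y : seqZ R).

(* [toeplitz ps g u] is [\sum_(p <- ps) p.1 S^p.2 + S^g M_u]. *)
Definition toeplitz u : op R := fun x n =>
  \sum_(p <- ps) p.1 * x (n - p.2) + u (n - g) * x (n - g).

(** The constant coefficients commute with shifts; only the potential is moved, in the opposite
    direction. *)
Lemma toeplitz_shiftk (k : int) u x :
  toeplitz u (shiftk k x) = shiftk k (toeplitz (shiftk (- k) u) x).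
Proof.
apply/funext => n; rewrite /toeplitz /shiftk; congr (_ + _).
  by apply: eq_bigr => p _; congr (_ * x _); rewrite addrAC.
by congr (u _ * x _); rewrite ?opprK; lia.
Qed.

Lemma toeplitzD u x y :
  toeplitz u (fun n => x n + y n) = fun n => toeplitz u x n + toeplitz u y n.
Proof.
apply/funext => n; rewrite /toeplitz addrACA mulrDr -big_split; congr (_ + _).
by apply: eq_bigr => p _; rewrite mulrDr.
Qed.

Lemma toeplitzZ u (z : R[i]) x :
  toeplitz u (fun n => z * x n) = fun n => z * toeplitz u x n.
Proof.
apply/funext => n; rewrite /toeplitz mulrDr mulr_sumr mulrCA; congr (_ + _).
by apply: eq_bigr => p _; rewrite mulrCA.
Qed.

(** The potential multiplies [x] before the shift, so its values off the support of [x] are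
    invisible. *)
Lemma eq_toeplitz u v x : (forall n, x n != 0 -> u n = v n) ->
  toeplitz u x = toeplitz v x.
Proof.
move=> uv; apply/funext => n; rewrite /toeplitz; congr (_ + _).
by have [->|/uv ->//] := eqVneq (x (n - g)) 0; rewrite !mulr0.
Qed.

End Toeplitz.

(** * Boundedness on [l2] for bounded potentials *)

Section Boundedness.
Variables (R : realType) (g : int).

Lemma toeplitz_bounded (ps : seq (R[i] * int)) (u : seqZ R) (B : R) :
  (forall n, cmod2 (u n) <= B) ->
  exists2 K : R, 0 <= K & forall (x : seqZ R) (M : R),
    (sqnorm x <= M%:E)%E -> (sqnorm (toeplitz ps g u x) <= (K * M)%:E)%E.
Proof.
move=> uB; elim: ps => [|[z k] ps [K K0 IH]].
  exists B => [|x M xM]; first by rewrite (le_trans _ (uB 0))// cmod2_ge0.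
  have -> : toeplitz [::] g u x = shiftk g (fun n => u n * x n).
    by apply/funext => n; rewrite /toeplitz big_nil add0r.
  by rewrite sqnorm_shiftk; exact: sqnorm_mul_le.
exists (2 * cmod2 z + 2 * K) => [|x M xM].
  by rewrite addr_ge0// mulr_ge0// cmod2_ge0.
have -> : toeplitz ((z, k) :: ps) g u x
    = fun n => z * shiftk k x n + toeplitz ps g u x n.
  by apply/funext => n; rewrite /toeplitz big_cons addrA.
(* Young's inequality with [d = 1], which gives the factor 2 on each summand. *)
have -> : (2 * cmod2 z + 2 * K) * M
    = (1 + 1) * (cmod2 z * M) + (1 + 1^-1) * (K * M) by field.
apply: sqnormD_le => //; last exact: IH.
by apply: (@sqnorm_mul_le _ _ _ (fun=> z)); rewrite ?sqnorm_shiftk.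
Qed.

Lemma toeplitz_l2 (ps : seq (R[i] * int)) (u : seqZ R) (B : R) :
  (forall n, cmod2 (u n) <= B) -> forall x, l2 x -> l2 (toeplitz ps g u x).
Proof.
move=> /(toeplitz_bounded ps)[K _ TK] x /fineK_l2 xX.
by apply: (@l2_le _ _ (K * fine (sqnorm x))); apply: TK; rewrite xX.
Qed.

End Boundedness.

(** * Transfer of lower bounds from [c] to [b] *)

Section Transfer.
Variables (R : realType) (ps : seq (R[i] * int)) (g : int) (b c : seqZ R).
Variable B : R.
Hypotheses (bB : forall n, cmod2 (b n) <= B) (bc : subwords b `<=` subwords c).
Local Notation T := (toeplitz ps g).

(** Shift [x] to where [c] repeats the values of [b] on [F]. Shifting back leaves the norms
    unchanged and turns [c] into a potential that agrees with [b] on the support of [x]. *)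
Lemma toeplitz_lower_fset (m : R) (F : {fset int}) (x : seqZ R) :
  (forall y, l2 y -> (m%:E * sqnorm y <= sqnorm (T c y))%E) ->
  l2 x -> (forall n, n \notin F -> x n = 0) ->
  (m%:E * sqnorm x <= sqnorm (T b x))%E.
Proof.
move=> H xl2 xF; have [k ck] := subwords_fset F bc.
have := H _ (l2_shiftk k xl2).
rewrite toeplitz_shiftk !sqnorm_shiftk (@eq_toeplitz _ _ _ _ b)// => n xn.
have [nF|/xF] := boolP (n \in F); last by move=> xn0; rewrite xn0 eqxx in xn.
by rewrite /shiftk opprK ck.
Qed.

Lemma toeplitz_lower (m : R) : 0 <= m ->
  (forall y, l2 y -> (m%:E * sqnorm y <= sqnorm (T c y))%E) ->
  forall x, l2 x -> (m%:E * sqnorm x <= sqnorm (T b x))%E.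
Proof.
move=> m0 H x xl2; have [K K0 TK] := toeplitz_bounded g ps bB.
have /fineK_l2 := toeplitz_l2 g ps bB xl2; set Q := fine _ => QE.
have /fineK_l2 := xl2; set X := fine _ => XE.
rewrite -QE -XE -EFinM lee_fin; apply/ler_addgt0Pr => e e0.
have Q0 : 0 <= Q by rewrite -lee_fin QE sqnorm_ge0.
(* Chosen so that [d * Q <= e / 2]; the added 1 keeps the denominator positive when [Q = 0]. *)
pose d := e / 2 / (Q + 1).
have d0 : 0 < d by rewrite !divr_gt0// ltr_wpDl.
(* [A - 1] is the total coefficient of the tail [t] in the final estimate. It contains [d^-1], so
   the truncation is chosen after [d]. *)
pose A := m + (1 + d^-1) * K + 1.
have A0 : 0 < A.
  by rewrite ltr_wpDl// addr_ge0// mulr_ge0// addr_ge0// invr_ge0 ltW.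
pose t := e / 2 / A.
have t0 : 0 < t by rewrite !divr_gt0.
have [F XF] : exists F : {fset int}, X - t < \sum_(n <- F) cmod2 (x n).
  by apply: sqnorm_gtP; rewrite -XE lte_fin ltrBlDr ltrDl.
pose xF := fun n => if n \in F then x n else 0.
pose r := fun n => if n \in F then 0 else - x n.
have xFX : (sqnorm xF <= X%:E)%E.
  by rewrite XE (sqnorm_split F x) leeDl// sqnorm_ge0.
have /l2_le xFl2 := xFX.
have xF_ge : ((\sum_(n <- F) cmod2 (x n))%:E <= sqnorm xF)%E.
  rewrite (_ : \sum_(n <- F) _ = \sum_(n <- F) cmod2 (xF n)) ?sum_le_sqnorm//.
  by rewrite !big_seq; apply: eq_bigr => n nF; rewrite /xF nF.
have rt : (sqnorm r <= t%:E)%E.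
  have := sqnorm_split F x; rewrite -/xF -/r -XE.
  move: xF_ge; rewrite -(fineK_l2 xFl2); case: (sqnorm r) => [s||]//.
  by rewrite !lee_fin => h [] XS; move: XF; rewrite XS; lra.
(* By linearity the truncation error is [T b r], whose square norm is at most [K * t]. *)
have TxF : T b xF = fun n => T b x n + T b r n.
  rewrite -toeplitzD; congr (T b _); apply/funext => n; rewrite /xF /r.
  by case: ifP; rewrite ?addr0 ?subrr.
have : (m%:E * sqnorm xF <= ((1 + d) * Q + (1 + d^-1) * (K * t))%:E)%E.
  apply: (le_trans (@toeplitz_lower_fset m F xF H xFl2 _)).
    by move=> n; rewrite /xF => /negbTE ->.
  by rewrite TxF; apply: sqnormD_le; rewrite ?QE//; exact: TK.
move: xF_ge; rewrite -(fineK_l2 xFl2) -EFinM !lee_fin.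
set Y := fine _ => SY mY.
have mXt : m * (X - t) <= m * Y.
  by rewrite ler_wpM2l// (le_trans (ltW XF)).
have dQ : d * Q <= e / 2.
  rewrite /d mulrAC ler_pdivrMr ?ltr_wpDl// ler_wpM2l//; last by rewrite lerDl.
  by rewrite divr_ge0 ?(ltW e0).
have tA : t * (A - 1) <= e / 2.
  rewrite /t mulrAC ler_pdivrMr// ler_wpM2l//; last by rewrite gerBl.
  by rewrite divr_ge0 ?(ltW e0).
have -> : m * X = m * (X - t) + m * t by ring.
apply: (@le_trans _ _ ((1 + d) * Q + (1 + d^-1) * (K * t) + m * t)).
  by rewrite lerD2r (le_trans mXt).
have -> : (1 + d) * Q + (1 + d^-1) * (K * t) + m * t = Q + (d * Q + t * (A - 1)).
  by rewrite /A; ring.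
by rewrite lerD2l [leRHS]splitr lerD.
Qed.

End Transfer.

(** * Limits along an ultrafilter *)

Section UltraLimit.
Variables (R : realType) (U : set_system nat).
Hypothesis UU : UltraFilter U.
Implicit Types (f h : nat -> R[i]) (z t : R[i]).

(** Compactness of [[-B, B]] gives a cluster point. An ultrafilter converges to each of its cluster
    points: if the preimage of a neighbourhood [V] were missing, that of its complement would be
    present and would have to meet [V]. *)
Lemma ultra_bounded_cvg (f : nat -> R) (B : R) :
  (forall N, `|f N| <= B) -> exists l : R, f @ U --> l.
Proof.
move=> fB; have [|l [_ cl]] := @segment_compact R (- B) B (f @ U) _.
  by apply: (@filterE _ U) => N; rewrite /= in_itv/= -ler_norml.
exists l => V Vl; have [//|UV] := in_ultra_setVsetC (f @^-1` V) UU.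
by have [y []] := cl (~` V) V UV Vl.
Qed.

Definition ucvg f z : Prop :=
  (fun N => complex.Re (f N)) @ U --> complex.Re z /\
  (fun N => complex.Im (f N)) @ U --> complex.Im z.

Lemma ucvg_bounded f (B : R) : (forall N, cmod2 (f N) <= B) ->
  exists z, ucvg f z.
Proof.
move=> fB; have sq (r : R) : r ^+ 2 <= B -> `|r| <= Num.sqrt B.
  by move=> rB; rewrite -sqrtr_sqr ler_wsqrtr.
have [r rP] : exists r : R, (fun N => complex.Re (f N)) @ U --> r.
  apply: (@ultra_bounded_cvg _ (Num.sqrt B)) => N; apply: sq.
  by rewrite (le_trans _ (fB N))// lerDl sqr_ge0.
have [s sP] : exists s : R, (fun N => complex.Im (f N)) @ U --> s.
  apply: (@ultra_bounded_cvg _ (Num.sqrt B)) => N; apply: sq.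
  by rewrite (le_trans _ (fB N))// lerDr sqr_ge0.
by exists (Complex r s).
Qed.

Lemma ucvg_unique f z t : ucvg f z -> ucvg f t -> z = t.
Proof.
case: z t => [x y] [u v] [/= fx fy] [/= fu fv].
by congr Complex; [exact: cvg_unique fx fu|exact: cvg_unique fy fv].
Qed.

Lemma ucvg_near_eq f h z : (\forall N \near U, f N = h N) ->
  ucvg f z -> ucvg h z.
Proof.
move=> fh [fx fy]; split.
  by apply: cvg_trans fx; apply: near_eq_cvg; apply: filterS fh => N ->.
by apply: cvg_trans fy; apply: near_eq_cvg; apply: filterS fh => N ->.
Qed.

Lemma ucvg_cst z : ucvg (fun=> z) z.
Proof. by split; exact: cvg_cst. Qed.

Lemma ucvgD f h z t : ucvg f z -> ucvg h t ->
  ucvg (fun N => f N + h N) (z + t).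
Proof.
case: z t => [x y] [u v] [/= fx fy] [/= hu hv]; split => /=.
  by under eq_fun do rewrite raddfD/=; exact: cvgD.
by under eq_fun do rewrite raddfD/=; exact: cvgD.
Qed.

Lemma ucvgZ f z t : ucvg f z -> ucvg (fun N => t * f N) (t * z).
Proof.
case: z t => [x y] [u v] [/= fx fy]; split => /=.
  rewrite [X in X @ U --> _](_ : _ =
    fun N => u * complex.Re (f N) - v * complex.Im (f N)); last first.
    by apply/funext => N; case: (f N).
  by apply: cvgB; apply: cvgMr.
rewrite [X in X @ U --> _](_ : _ =
  fun N => u * complex.Im (f N) + v * complex.Re (f N)); last first.
  by apply/funext => N; case: (f N).
by apply: cvgD; apply: cvgMr.
Qed.

Lemma ucvg_cmod2 f z : ucvg f z -> (fun N => cmod2 (f N)) @ U --> cmod2 z.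
Proof. by move=> [fx fy]; apply: cvgD; rewrite expr2; apply: cvgM. Qed.

Lemma ucvg_sum (I : Type) (s : seq I) (f : I -> nat -> R[i]) (z : I -> R[i]) :
  (forall i, ucvg (f i) (z i)) ->
  ucvg (fun N => \sum_(i <- s) f i N) (\sum_(i <- s) z i).
Proof.
move=> fz; elim: s => [|i s IH].
  by under eq_fun do rewrite big_nil; rewrite big_nil; exact: ucvg_cst.
by under eq_fun do rewrite big_cons; rewrite big_cons; exact: ucvgD.
Qed.

(** A Fatou-type bound: finite sums pass to the limit, and each one stays at most [M]. *)
Lemma sqnorm_ulimit (xs : nat -> seqZ R) (x : seqZ R) (M : R) :
  (forall n, ucvg (fun N => xs N n) (x n)) ->
  (forall N, (sqnorm (xs N) <= M%:E)%E) -> (sqnorm x <= M%:E)%E.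
Proof.
move=> xsx xsM; apply: sqnorm_le => F.
have : (fun N => \sum_(n <- F) cmod2 (xs N n)) @ U --> \sum_(n <- F) cmod2 (x n).
  elim: (enum_fset F) => [|n s IH].
    by under eq_fun do rewrite big_nil; rewrite big_nil; exact: cvg_cst.
  under eq_fun do rewrite big_cons.
  by rewrite big_cons; apply: cvgD => //; exact: ucvg_cmod2.
move/cvgr_to_le; apply; by apply: (@filterE _ U) => N; exact: sum_le.
Qed.

End UltraLimit.

(** * Solving the equation for [b] by limits of solutions for [c] *)

Section Solve.
Variables (R : realType) (ps : seq (R[i] * int)) (g : int) (b c : seqZ R).
Hypothesis bc : subwords b `<=` subwords c.
Local Notation T := (toeplitz ps g).

(* [x] is a coordinatewise ultralimit of translated solutions for [c]; [T b]
   commutes with such limits since each coordinate of [T b x] involves only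
   finitely many coordinates of [x]. *)
Lemma toeplitz_solve (y : seqZ R) (M : R) :
  (forall k, exists x, T c x = shiftk k y /\ (sqnorm x <= M%:E)%E) ->
  exists x, T b x = y /\ (sqnorm x <= M%:E)%E.
Proof.
move=> H; have /choice[k kP] := fun N => subwords_window N bc.
have /choice[xs xsP] : forall N, exists x : seqZ R,
    T (shiftk (- k N) c) x = y /\ (sqnorm x <= M%:E)%E.
  (* A solution for the right side [y] shifted by [k N], shifted back, solves with right side [y]
     and a translate of [c] that agrees with [b] on [[-N, N]]. *)
  move=> N; have [x [Tx xM]] := H (k N); exists (shiftk (- k N) x).
  rewrite sqnorm_shiftk; split=> //; apply/funext => n.
  have xE : x = shiftk (k N) (shiftk (- k N) x).
    by apply/funext => j; rewrite /shiftk; congr x; lia.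
  move: Tx; rewrite {1}xE toeplitz_shiftk => /(congr1 (fun v => v (n + k N))).
  by rewrite /shiftk addrK.
have [U [UU inU]] := ultraFilterLemma (F := \oo) _.
have /choice[x xP] : forall n, exists z, ucvg U (fun N => xs N n) z.
  move=> n; apply: (ucvg_bounded UU (B := M)) => N.
  by apply: cmod2_le_sqnorm; have [] := xsP N.
exists x; split; last first.
  by apply: (sqnorm_ulimit UU xP) => N; have [] := xsP N.
(* [T b x n] and [y n] are both limits of [T b (xs N) n]: the former by continuity of finite sums,
   the latter because the values eventually equal [y n]. *)
apply/funext => n; apply: (@ucvg_unique _ _ UU (fun N => T b (xs N) n)).
  apply: ucvgD; last by apply: ucvgZ; exact: xP.
  by apply: ucvg_sum => p; apply: ucvgZ; exact: xP.
apply: (ucvg_near_eq UU _ (ucvg_cst UU (y n))).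
(* Coordinate [n] reads the potential only at [n - g], which lies in the window once [N >= |n - g|].
   [U] contains all tails. *)
apply: inU; exists `|n - g|%N => // N /= nN.
have [<- _] := xsP N; rewrite /toeplitz; congr (_ + _ * _).
by rewrite /shiftk opprK kP.
Qed.

End Solve.

(** * Comparison of lower norms, invertibility and inverse norms *)

Section Comparison.
Variables (R : realType) (ps : seq (R[i] * int)) (g : int) (b c : seqZ R).
Variable B : R.
Hypotheses (bB : forall n, cmod2 (b n) <= B) (bc : subwords b `<=` subwords c).
Local Notation T := (toeplitz ps g).

(** Homogeneity: normalise a nonzero [y]. The squared form is the one that [toeplitz_lower]
    transfers. *)
Lemma lower_norm_sqnorm (u : seqZ R) (r : R) : 0 <= r ->
  (r%:E <= lower_norm (T u))%E ->
  forall y, l2 y -> ((r ^+ 2)%:E * sqnorm y <= sqnorm (T u y))%E.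
Proof.
move=> r0 rT y yl2; have := sqnorm_ge0 y; rewrite le_eqVlt => /orP[/eqP <-|y0].
  by rewrite mule0 sqnorm_ge0.
have z1 := sqnormZ_inv_sqrt yl2 y0.
set s := Num.sqrt _ in z1; set z := (fun n => _) in z1.
have : (r%:E <= enorm (T u z))%E.
  by apply: (le_trans rT); apply: ereal_inf_lbound; exists z => //; apply/unit_l2E.
rewrite enorm_geE// toeplitzZ => rz.
have [Tyl2|] := boolP (sqnorm (T u y) < +oo)%E; last first.
  by rewrite -leNgt => /(le_trans _); apply; exact: leey.
move: (fineK_l2 Tyl2) (fineK_l2 yl2) y0; rewrite /s.
set Y := fine (sqnorm y); set W := fine _ => WE YE.
rewrite -WE -YE lte_fin -EFinM lee_fin => Y0.
have : (sqnorm (fun n => (s^-1%:C%C * T u y n)%R) <= (Y^-1 * W)%:E)%E.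
  apply: sqnorm_mul_le; last by rewrite WE.
  by move=> n; rewrite cmod2_real exprVn sqr_sqrtr// ltW.
by move=> /(le_trans rz); rewrite lee_fin mulrC ler_pdivlMr.
Qed.

Lemma lower_norm_toeplitz (Bc : R) : (forall n, cmod2 (c n) <= Bc) ->
  (lower_norm (T c) <= lower_norm (T b))%E.
Proof.
move=> cB; have L0 : (0 <= lower_norm (T c))%E.
  by apply: le_ereal_inf_tmp => _ [x _ <-]; exact: enorm_ge0.
(* A coordinate vector is a unit vector with image in [l2], so the infimum is a real number. *)
have Lfin : (lower_norm (T c) < +oo)%E.
  have d1 : unit_l2 (deltaZ R 0) by apply/unit_l2E/sqnorm_deltaZ.
  apply: (@le_lt_trans _ _ (enorm (T c (deltaZ R 0)))).
    by apply: ereal_inf_lbound; exists (deltaZ R 0).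
  by rewrite enormE ?ltry//; apply: (toeplitz_l2 g ps cB); exact: l2_deltaZ.
have LE : (fine (lower_norm (T c)))%:E = lower_norm (T c).
  by rewrite fineK// ge0_fin_numE.
set r := fine _ in LE.
have r0 : 0 <= r by rewrite -lee_fin LE.
apply: le_ereal_inf_tmp => _ [x [xl2 x1] <-]; rewrite -LE enorm_geE//.
have x1' : sqnorm x = 1%E by apply/unit_l2E.
rewrite -[X in (X <= _)%E]mule1 -x1'.
apply: (toeplitz_lower bB bc) => //; first exact: sqr_ge0.
by apply: lower_norm_sqnorm => //; rewrite LE.
Qed.

Lemma is_inverse_sqnorm (A Ai : op R) : is_inverse A Ai ->
  exists2 M : R, 0 < M & forall (y : seqZ R) (Y : R),
    (sqnorm y <= Y%:E)%E -> (sqnorm (Ai y) <= (M * Y)%:E)%E.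
Proof.
(* The constant [M] carries no sign condition; adding 1 to its square makes the new one positive,
   hence invertible. *)
case=> _ Ail2 _ _ [M MP]; exists (M ^+ 2 + 1).
  by rewrite ltr_wpDl ?sqr_ge0.
move=> y Y yY; have yl2 := l2_le yY; have := MP _ yl2.
move: yY; rewrite (enormE (Ail2 _ yl2)) (enormE yl2) -EFinM.
rewrite -(fineK_l2 yl2) -(fineK_l2 (Ail2 _ yl2)) !lee_fin.
have : 0 <= fine (sqnorm y) by rewrite fine_ge0 ?sqnorm_ge0.
have : 0 <= fine (sqnorm (Ai y)) by rewrite fine_ge0 ?sqnorm_ge0.
set s := fine _; set t := fine _ => s0 t0 tY sMt.
have : s <= M ^+ 2 * t.
  rewrite -(sqr_sqrtr s0) -(sqr_sqrtr t0) -exprMn lerXn2r// nnegrE ?sqrtr_ge0//.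
  by rewrite (le_trans _ sMt)// sqrtr_ge0.
move=> /le_trans; apply; apply: (@le_trans _ _ ((M ^+ 2 + 1) * t)).
  by rewrite ler_wpM2r// lerDl.
by rewrite ler_wpM2l// addr_ge0// sqr_ge0.
Qed.

(** The bound concerns only the translates of one [y]. This serves both the existence of an inverse
    and its sharp norm bound. *)
Lemma toeplitz_solve_inverse (Ci : op R) (y : seqZ R) (M : R) :
  is_inverse (T c) Ci -> l2 y ->
  (forall k, (sqnorm (Ci (shiftk k y)) <= M%:E)%E) ->
  exists x, T b x = y /\ (sqnorm x <= M%:E)%E.
Proof.
move=> [_ _ _ TCi _] yl2 CiM; apply: (toeplitz_solve bc) => k.
by exists (Ci (shiftk k y)); rewrite TCi//; exact: l2_shiftk.
Qed.

(** A bounded inverse bounds [T c] from below by [M^-1] in square norms. The bound passes to [T b]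
    and is applied to the difference [z]. *)
Lemma toeplitz_inj : invertible (T c) ->
  forall x y, l2 x -> l2 y -> T b x = T b y -> x = y.
Proof.
move=> [Ci Cinv] x y xl2 yl2 Txy; have [M M0 MP] := is_inverse_sqnorm Cinv.
have [Tcl2 _ CiT _ _] := Cinv.
pose z n := x n + -1 * y n.
have zl2 : l2 z.
  apply: l2_le; apply: (@sqnormD_le _ 1 (fine (sqnorm x))) => //.
    by rewrite fineK_l2.
  apply: (@sqnorm_mul_le _ 1 (fine (sqnorm y)) (fun=> -1)); last first.
    by rewrite fineK_l2.
  by move=> _; rewrite cmod2N cmod21.
have Tz : T b z = fun=> 0.
  by rewrite toeplitzD toeplitzZ Txy; apply/funext => n; ring.
have lowc u : l2 u -> (M^-1%:E * sqnorm u <= sqnorm (T c u))%E.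
  move=> ul2; have := Tcl2 _ ul2 => /fineK_l2 TuE.
  have : (sqnorm u <= (M * fine (sqnorm (T c u)))%:E)%E.
    by rewrite -{1}(CiT _ ul2); apply: MP; rewrite TuE.
  rewrite -TuE -(fineK_l2 ul2) -EFinM !lee_fin.
  by rewrite ler_pdivrMl.
have iM0 : 0 <= M^-1 by rewrite invr_ge0 ltW.
have := toeplitz_lower bB bc iM0 lowc zl2.
rewrite Tz sqnorm0 -(fineK_l2 zl2) -EFinM lee_fin pmulr_rle0 ?invr_gt0// => z0.
have : sqnorm z = 0%E.
  apply/eqP; rewrite eq_le sqnorm_ge0 andbT -(fineK_l2 zl2).
  by rewrite lee_fin.
move=> /sqnorm_eq0 zE; apply/funext => n.
have := congr1 (fun v => v n) zE; rewrite /z mulN1r => /eqP.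
by rewrite subr_eq0 => /eqP.
Qed.

(** Chosen solutions give a bounded right inverse [Bi]; injectivity of [T b] on [l2] makes it a left
    inverse. *)
Lemma toeplitz_invertible : invertible (T c) -> invertible (T b).
Proof.
move=> Tinv; have inj := toeplitz_inj Tinv.
have [Ci Cinv] := Tinv; have [M M0 MP] := is_inverse_sqnorm Cinv.
have /choice[Bi BiP] : forall y : seqZ R, exists x, l2 y ->
    T b x = y /\ (sqnorm x <= (M * fine (sqnorm y))%:E)%E.
  (* Outside [l2] the value of [Bi] is arbitrary. *)
  move=> y; have [yl2|yl2] := pselect (l2 y); last by exists y.
  have [k|x xP] := @toeplitz_solve_inverse Ci y (M * fine (sqnorm y)) Cinv yl2.
    by apply: MP; rewrite sqnorm_shiftk fineK_l2.
  by exists x.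
have Bil2 y : l2 y -> l2 (Bi y) by move=> /BiP[_ /l2_le].
have Tbl2 := toeplitz_l2 g ps bB.
exists Bi; split => // [x xl2|y /BiP[]//|].
  have Tx := Tbl2 _ xl2; apply: inj => //; first exact: Bil2.
  by have [] := BiP _ Tx.
exists (Num.sqrt M) => y yl2; have [_ yM] := BiP _ yl2.
rewrite (enormE yl2) -EFinM -sqrtrM ?(ltW M0)// enorm_leE ?sqrtr_ge0//.
by rewrite sqr_sqrtr// mulr_ge0 ?(ltW M0)// fine_ge0 ?sqnorm_ge0.
Qed.

(** For a unit vector [y], the translates of [y] are unit vectors too, so [T b x = y] has a solution
    of norm at most the inverse norm for [c]. Any inverse of [T b] must return this [x]. *)
Lemma inv_norm_toeplitz : (inv_norm (T b) <= inv_norm (T c))%E.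
Proof.
rewrite {2}/inv_norm; case: pselect => [Tinv|]; last by rewrite leey.
rewrite /inv_norm; case: pselect => [_|/(_ (toeplitz_invertible Tinv))//].
have [Ci Cinv] := Tinv.
apply: ge_ereal_sup => _ [Bi [y [Binv y1 ->]]].
set s := ereal_sup _.
have Cs k : (enorm (Ci (shiftk k y)) <= s)%E.
  apply: ereal_sup_ubound; exists Ci, (shiftk k y); split=> //.
  exact: unit_l2_shiftk.
have s0 : (0 <= s)%E by apply: le_trans (Cs 0); exact: enorm_ge0.
move: s s0 Cs => [r||]; rewrite ?leey// lee_fin => r0 Cs.
have [k|x [Tx xr]] := @toeplitz_solve_inverse Ci y (r ^+ 2) Cinv y1.1.
  by rewrite -enorm_leE.
have [_ _ BiT _ _] := Binv.
by rewrite -Tx BiT ?enorm_leE//; exact: l2_le xr.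
Qed.

End Comparison.

(** * Reduction to constant coefficients *)

Section ShiftInvariantBand.
Variables (R : realType) (w : nat) (a : int -> seqZ R).

Lemma band_op_coeff_constant :
  (forall x : seqZ R, l2 x -> band_op w a (shiftS x) = shiftS (band_op w a x)) ->
  forall (j : 'I_(2 * w).+1) (n : int), a (j%:Z - w%:Z) n = a (j%:Z - w%:Z) 0.
Proof.
move=> aS j; have step n : a (j%:Z - w%:Z) n = a (j%:Z - w%:Z) (n - 1).
  (* Test commutation on the unit vector at [m] and read off coordinate [n]: on each side only the
     [j]-th diagonal contributes. *)
  pose m := n - 1 - (j%:Z - w%:Z).
  have := congr1 (fun v => v n) (aS _ (l2_deltaZ R m)).
  rewrite /band_op /shiftS /= (bigD1 j)//= [in RHS](bigD1 j)//=.
  rewrite {1 3}/deltaZ !ifT ?mulr1; try by apply/eqP; rewrite /m; lia.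
  rewrite !big1 ?addr0// => i ij; rewrite /deltaZ ifF ?mulr0//;
    by apply: contra_neqF ij => /eqP; rewrite /m => h; apply/val_inj => /=; lia.
elim/int_ind => // n IH; first by rewrite step -IH; congr (a _ _); lia.
by rewrite -IH [RHS]step; congr (a _ _); lia.
Qed.

End ShiftInvariantBand.

(** One list [ps] serves all potentials, so [b] and [c] are compared with the same constant part. *)
Lemma Hop_toeplitz (R : realType) (w : nat) (a : int -> seqZ R) (g : int) :
  (forall x : seqZ R, l2 x -> band_op w a (shiftS x) = shiftS (band_op w a x)) ->
  exists ps, forall u : seqZ R, Hop (band_op w a) g u = toeplitz ps g u.
Proof.
move=> /band_op_coeff_constant acst.
exists [seq (a (j%:Z - w%:Z) 0, j%:Z - w%:Z) | j : 'I_(2 * w).+1] => u.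
apply/funext => x; apply/funext => n; rewrite /Hop /toeplitz; congr (_ + _).
by rewrite big_map big_enum/=; apply: eq_bigr => j _; rewrite acst.
Qed.

(** The spectral parameter becomes one more constant coefficient, on the zeroth power of the shift,
    so resolvents need no separate treatment. *)
Lemma sub_scal_toeplitz (R : realType) (ps : seq (R[i] * int)) (g : int)
    (u : seqZ R) (lam : R[i]) :
  sub_scal (toeplitz ps g u) lam = toeplitz ((- lam, 0) :: ps) g u.
Proof.
apply/funext => x; apply/funext => n.
by rewrite /sub_scal /toeplitz big_cons subr0 /= mulNr addrC addrA.
Qed.

Unset Implicit Arguments.

Theorem theorem4p3 (R : realType) (Sigma : set R[i])
  (w : nat) (a : int -> seqZ R) (gamma : int) (b c : seqZ R) :
  Sigma !=set0 -> ccompact Sigma ->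
  bounded_coeffs w a ->
  (forall x : seqZ R, l2 x -> band_op w a (shiftS x) = shiftS (band_op w a x)) ->
  (forall n, Sigma (b n)) -> (forall n, Sigma (c n)) ->
  subwords b `<=` subwords c ->
  [/\ (lower_norm (Hop (band_op w a) gamma c) <= lower_norm (Hop (band_op w a) gamma b))%E,
      (forall lam : R[i],
         (resolvent_norm (Hop (band_op w a) gamma b) lam
          <= resolvent_norm (Hop (band_op w a) gamma c) lam)%E),
      spectrum (Hop (band_op w a) gamma b) `<=` spectrum (Hop (band_op w a) gamma c)
    & forall eps : R, 0 < eps ->
        pseudospectrum eps (Hop (band_op w a) gamma b)
        `<=` pseudospectrum eps (Hop (band_op w a) gamma c)].
Proof.
move=> _ /ccompact_bounded[B SB] _ aS bS cS bc.
have [ps HT] := Hop_toeplitz gamma aS.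
have bB n : cmod2 (b n) <= B by exact: SB.
have cB n : cmod2 (c n) <= B by exact: SB.
have res (lam : R[i]) : (resolvent_norm (Hop (band_op w a) gamma b) lam
    <= resolvent_norm (Hop (band_op w a) gamma c) lam)%E.
  rewrite /resolvent_norm !HT !sub_scal_toeplitz.
  exact: (inv_norm_toeplitz _ _ bB bc).
split=> // [|lam|eps eps0 lam].
- by rewrite !HT; exact: (lower_norm_toeplitz _ _ bB bc cB).
(* Contrapositive: invertibility passes from [c] to [b]. *)
- rewrite /spectrum /= !HT !sub_scal_toeplitz => nb nc; apply: nb.
  exact: (toeplitz_invertible bB bc nc).
- by move=> /lt_le_trans; apply; exact: res.
Qed.
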